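(* Let $T,T'$ be contractions on a complex Hilbert space $\mathcal{H}$ such that $T$ is Harnack dominated by $T'$. Then $T$ is uniformly Ces\`aro ergodic if and only if $T'$ is uniformly Ces\`aro ergodic. Also, $\{T^n\}$ converges uniformly if and only if $\{T'^n\}$ converges uniformly.
   Context: A contraction on $\mathcal{H}$ is a bounded linear operator of norm at most $1$. For contractions $T,T'$ on $\mathcal{H}$, $T$ is Harnack dominated by $T'$ if there is a constant $c\ge 1$ such that $\operatorname{Re} p(T)\le c\,\operatorname{Re} p(T')$ for every analytic polynomial $p$ with $\operatorname{Re} p(z)\ge 0$ for all $|z|\le 1$; here $\operatorname{Re} A=\frac12(A+A^* )$ for an operator $A$. The Ces\`aro means of $T$ are $M_n(T)=\frac{1}{n+1}\sum_{j=0}^n T^j$; $T$ is uniformly Ces\`aro ergodic if $\{M_n(T)\}$ converges in operator norm. Uniform convergence of a sequence of operators means convergence in operator norm. *)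

(* Defs.v *)
From HB Require Import structures.
From mathcomp Require Import all_boot all_order all_algebra.
From mathcomp Require Export sesquilinear complex.
From mathcomp Require Import all_classical all_reals all_analysis.
Set Implicit Arguments.
Unset Strict Implicit.
Unset Printing Implicit Defensive.
Import Order.TTheory GRing.Theory Num.Theory.
Import numFieldNormedType.Exports.
Local Open Scope classical_set_scope.
Local Open Scope complex_scope.
Local Open Scope ring_scope.

Section operators.
Context {R : realType} {H : completeNormedModType R[i]}.
Implicit Types A B : H -> H.

(* Norms on H are R[i]-valued, hence the projection to R. This is the operator
   norm only for bounded A: otherwise the set has no supremum in R. *)
Definition opnorm A : R :=
  sup [set complex.Re `|A x| | x in [set x : H | `|x| <= 1]].

Definition bounded_operator (A : {linear H -> H}) : Prop :=
  bounded_near A (nbhs (0 : H)).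

Definition contraction_operator (T : {linear H -> H}) : Prop :=
  bounded_operator T /\ opnorm T <= 1.

(* Intended for sequences of bounded operators only (see opnorm). *)
Definition uniformly_convergent (S : nat -> H -> H) : Prop :=
  exists2 L : {linear H -> H}, bounded_operator L &
    opnorm (S n \- L) @[n --> \oo] --> (0 : R).

Definition cesaro_mean (T : H -> H) (n : nat) : H -> H :=
  (n.+1%:R^-1 : R[i]) *: \sum_(j < n.+1) iter j T.

Definition uniformly_cesaro_ergodic (T : H -> H) : Prop :=
  uniformly_convergent (cesaro_mean T).

Definition poly_operator (p : {poly R[i]}) (T : H -> H) : H -> H :=
  \sum_(k < size p) p`_k *: iter k T.

Variable ip : {dot H for Num.conj}.

(* Exists and is unique for bounded A by the Riesz representation theorem;
   the default value 0 is irrelevant. *)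
Definition adjoint A : H -> H :=
  xget 0 [set B | forall x y, ip (A x) y = ip x (B y)].

Definition operator_Re A : H -> H := (2%:R^-1 : R[i]) *: (A + adjoint A).

(* 0 <= z in R[i] means that z is real and nonnegative. *)
Definition operator_le A B : Prop := forall x, 0 <= ip ((B - A) x) x.

Definition harnack_dominated (T T' : H -> H) : Prop :=
  exists2 c : R, 1 <= c &
    forall p : {poly R[i]},
      (forall z : R[i], `|z| <= 1 -> 0 <= complex.Re p.[z]) ->
      operator_le (operator_Re (poly_operator p T))
                  (c%:C *: operator_Re (poly_operator p T')).

End operators.

(* Main.v *)
Require Import Defs.
From mathcomp Require Import all_boot all_order all_algebra.
From mathcomp Require Import cyclic separable cyclotomic.
From mathcomp Require Import all_classical all_reals all_analysis.
From mathcomp Require Import zify ring lra.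
Set Implicit Arguments.
Unset Strict Implicit.
Unset Printing Implicit Defensive.
Import Order.TTheory GRing.Theory Num.Theory.
Import numFieldNormedType.Exports.
Local Open Scope classical_set_scope.
Local Open Scope complex_scope.
Local Open Scope ring_scope.

(** Both kinds of convergence are rephrased as a spectral gap on the orthogonal
    complement of the fixed space of the contraction, and a gap passes through
    Harnack domination in both directions.

    Characterizations.  For a contraction T, the Cesaro means converge in norm
    iff the orthogonal projector L onto Fix(T) is available as a linear map and
    |y| <= K |y - T y| for y orthogonal to Fix(T)
    (uniformly_cesaro_ergodicP).  The powers converge in norm iff L is
    available and |y| <= K |y - w T y| for all such y and all unimodular w, with
    K independent of w (uniformly_convergent_powerP).  In the latter, the gap
    implies decay as follows: with y_w the sum of the w^j T^j y for j < n, one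
    has y_w - w T y_w = y - w^n T^n y, hence |y_w| <= 2 K |y|; averaging
    |y_w|^2 over the n-th roots of unity and using Parseval gives
    n |T^n y|^2 <= sum_(j < n) |T^j y|^2 <= 4 K^2 |y|^2 (power_decay).

    Domination as numerical inequalities.  Since Re A has the quadratic form
    Re <A x, x>, domination says Re <p(T) x, x> <= c Re <p(T') x, x> for every
    polynomial p with nonnegative real part on the disc.  This is where the
    existence of adjoints, hence the projection and Riesz theorems, enters.  The
    relation is inherited by (w T, w T') for unimodular w, because p(w z) is
    again an admissible polynomial.  Two kinds of polynomials are enough:
    - p = 1 - z.  As |x - T x|^2 <= 2 Re <x - T x, x> for a contraction, one gets
      |x - T x|^2 <= 2 c |x| |x - T' x|: fixed vectors of T' are fixed by T, and
      a gap of T is a gap of T' (harnack_gap_up).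
    - the analytic Fejer polynomials p_n, with p_n(1) = n^2.  If T y is close to
      y then Re <p_n(T) y, y> is close to n^2 |y|^2, whereas p_n(T') y is only of
      size O(n) when T' has a gap at y.  For n large this turns a gap of T' into
      a gap of T (harnack_gap_down).  If T x = x, split x = u + v with u
      orthogonal to the range of 1 - T' and v in the closure of that range: u is
      fixed by T', hence v = x - u is fixed by T, while |p_n(T') v| = o(n^2), so
      v = 0.  Thus T and T' have the same fixed vectors (harnack_fix). *)

(** * The real Hilbert structure *)

Section RealNorm.
Context {R : realType} {H : completeNormedModType R[i]}.
Implicit Types (x y z : H) (a : R) (w : R[i]).

(** The norm of [H] takes values in [R[i]], where the order is partial;
    inequalities are proved for this real-valued version. *)
Definition rnorm x : R := complex.Re `|x|.

Lemma rnormE x : `|x| = (rnorm x)%:C.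
Proof. by rewrite /rnorm RRe_real // normr_real. Qed.

Lemma rnorm_ge0 x : 0 <= rnorm x.
Proof. by rewrite -ler0c -rnormE. Qed.

Lemma rnormD x y : rnorm (x + y) <= rnorm x + rnorm y.
Proof. by rewrite -lecR rmorphD /= -!rnormE ler_normD. Qed.

Lemma rnormN x : rnorm (- x) = rnorm x.
Proof. by rewrite /rnorm normrN. Qed.

Lemma rnormC x y : rnorm (x - y) = rnorm (y - x).
Proof. by rewrite -rnormN opprB. Qed.

Lemma rnormB x y : rnorm (x - y) <= rnorm x + rnorm y.
Proof. by rewrite -(rnormN y) rnormD. Qed.

Lemma rnorm0 : rnorm (0 : H) = 0.
Proof. by rewrite /rnorm normr0. Qed.

Lemma rnorm_eq0 x : rnorm x = 0 -> x = 0.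
Proof. by move=> x0; apply/normr0_eq0; rewrite rnormE x0. Qed.

Lemma rnormZ_unit w x : `|w| = 1 -> rnorm (w *: x) = rnorm x.
Proof. by move=> w1; rewrite /rnorm normrZ w1 mul1r. Qed.

Lemma rnormZC w x : rnorm (w *: x) = complex.Re `|w| * rnorm x.
Proof.
by rewrite {1}/rnorm normrZ rnormE; case: `|w| => u v /=; rewrite mulr0 subr0.
Qed.

Lemma rnormZ a x : rnorm (a%:C *: x) = `|a| * rnorm x.
Proof.
apply: complexI; rewrite rmorphM /= -!rnormE normrZ; congr (_ * _).
by rewrite normc_def /= expr0n addr0 sqrtr_sqr.
Qed.

Lemma rnormMn n x : rnorm (x *+ n) = rnorm x *+ n.
Proof.
rewrite -scaler_nat -(rmorph_nat (real_complex R)) rnormZ ger0_norm ?ler0n //.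
by rewrite mulr_natl.
Qed.

Lemma rnorm_sum (I : Type) (s : seq I) (P : pred I) (F : I -> H) :
  rnorm (\sum_(i <- s | P i) F i) <= \sum_(i <- s | P i) rnorm (F i).
Proof.
elim/big_ind2: _ => //; first by rewrite rnorm0.
by move=> x1 a1 x2 a2 h1 h2; apply: le_trans (rnormD _ _) _; apply: lerD.
Qed.

Lemma rnorm_complete (s : nat -> H) :
  (forall e : R, 0 < e -> exists N, forall n m, (N <= n)%N -> (N <= m)%N ->
     rnorm (s n - s m) < e) ->
  exists l, forall e : R, 0 < e -> exists N, forall n, (N <= n)%N ->
     rnorm (s n - l) < e.
Proof.
move=> sC.
have : cvg (s @ \oo).
  apply: cauchy_cvg; apply: cauchy_exP => e e0.
  have eE : e = (complex.Re e)%:C by rewrite RRe_real // gtr0_real.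
  have /sC[N NP] : 0 < complex.Re e by rewrite -ltcR -eE.
  exists (s N); exists N => // n Nn /=.
  by rewrite -ball_normE /ball_ /= rnormE eE ltcR; exact: NP.
move/cvg_ex => [l /cvgrPdist_lt sl]; exists l => e e0.
have /sl[N _ NP] : 0 < e%:C by rewrite ltcR.
by exists N => n Nn; move: (NP n Nn); rewrite rnormE ltcR rnormC.
Qed.

End RealNorm.

Section RealInner.
Context {R : realType} {H : completeNormedModType R[i]}.
Variable ip : {dot H for Num.conj}.
Hypothesis norm_ip : forall x : H, `|x| = sqrtC (ip x x).
Implicit Types (x y z : H) (a : R) (w : R[i]).

Definition re_ip x y : R := complex.Re (ip x y).
Local Notation rip := re_ip.

Lemma Re_conj (z : R[i]) : complex.Re (Num.conj z) = complex.Re z.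
Proof. by case: z. Qed.

Lemma rip_sqr x : rnorm x ^+ 2 = rip x x.
Proof.
apply: complexI; rewrite rmorphXn /= -rnormE norm_ip sqrtCK /re_ip.
by rewrite RRe_real // ger0_real // dnorm_ge0.
Qed.

Lemma ripC x y : rip x y = rip y x.
Proof. by rewrite /re_ip hermC /= expr0 mul1r Re_conj. Qed.

Lemma ripDl x y z : rip (x + y) z = rip x z + rip y z.
Proof. by rewrite /re_ip linearDl raddfD. Qed.

Lemma ripNl x z : rip (- x) z = - rip x z.
Proof. by rewrite /re_ip linearNl raddfN. Qed.

Lemma ripBl x y z : rip (x - y) z = rip x z - rip y z.
Proof. by rewrite ripDl ripNl. Qed.

Lemma rip0l z : rip 0 z = 0.
Proof. by rewrite /re_ip linear0l. Qed.

Lemma ripDr x y z : rip z (x + y) = rip z x + rip z y.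
Proof. by rewrite !(ripC z) ripDl. Qed.

Lemma ripNr x z : rip z (- x) = - rip z x.
Proof. by rewrite !(ripC z) ripNl. Qed.

Lemma ripZl a x y : rip (a%:C *: x) y = a * rip x y.
Proof.
by rewrite /re_ip linearZl_LR /=; case: (ip x y) => u v /=; rewrite mul0r subr0.
Qed.

Lemma ripZr a x y : rip y (a%:C *: x) = a * rip y x.
Proof. by rewrite !(ripC y) ripZl. Qed.

Lemma ripMnl x y n : rip (x *+ n) y = rip x y *+ n.
Proof. by rewrite -scaler_nat -(rmorph_nat (real_complex R)) ripZl mulr_natl. Qed.

Lemma ip_eq0 x y : rip x y = 0 -> rip ('i *: x) y = 0 -> ip x y = 0.
Proof.
rewrite /re_ip linearZl_LR /=; case: (ip x y) => u v /= ->.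
by rewrite mul0r mul1r sub0r => /eqP; rewrite oppr_eq0 => /eqP ->.
Qed.

Lemma rnorm_addE x y : rnorm (x + y) ^+ 2 = rnorm x ^+ 2 + 2 * rip x y + rnorm y ^+ 2.
Proof. by rewrite !rip_sqr !ripDl !ripDr (ripC y x); ring. Qed.

Lemma rnorm_subE x y : rnorm (x - y) ^+ 2 = rnorm x ^+ 2 - 2 * rip x y + rnorm y ^+ 2.
Proof. by rewrite rnorm_addE ripNr rnormN; ring. Qed.

Lemma rip_le x y : rip x y <= rnorm x * rnorm y.
Proof.
have := rnorm_addE x y; have := rnormD x y.
rewrite -(@ler_pXn2r _ 2) ?nnegrE ?addr_ge0 ?rnorm_ge0 // => h e.
move: h; rewrite e; nra.
Qed.

Lemma rip_ge x y : - (rnorm x * rnorm y) <= rip x y.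
Proof. by have := rip_le (- x) y; rewrite ripNl rnormN; lra. Qed.

(** The first variation of a quantity at a minimum vanishes; used for every
    orthogonality relation that comes from minimality or from contractivity. *)
Lemma lin_quad0 a (b : R) : (forall t : R, t * a <= t ^+ 2 * b) -> a = 0.
Proof.
move=> h; apply/eqP/negPn/negP => a0.
have b0 : 0 < `|b| + 1 by rewrite ltr_wpDl.
have bb : b <= `|b| by exact: ler_norm.
have := h (a / (`|b| + 1)); have a2 : 0 < a ^+ 2 by rewrite exprn_even_gt0.
rewrite -(ler_pM2r (exprn_gt0 2 b0)).
have -> : a / (`|b| + 1) * a * (`|b| + 1) ^+ 2 = a ^+ 2 * (`|b| + 1).
  by field; rewrite gt_eqF.
have -> : (a / (`|b| + 1)) ^+ 2 * b * (`|b| + 1) ^+ 2 = a ^+ 2 * b.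
  by field; rewrite gt_eqF.
nra.
Qed.

End RealInner.

(** * Orthogonal decomposition and adjoints *)

Lemma natSinv_small (R : realType) (e : R) : 0 < e ->
  exists N, forall n, (N <= n)%N -> n.+1%:R^-1 < e.
Proof.
move=> e0; have [N _ NP] := near_infty_natSinv_lt (PosNum e0).
by exists N => n Nn; exact: NP.
Qed.

Lemma le_eps (R : realType) (a b : R) : (forall e : R, 0 < e -> a <= b + e) -> a <= b.
Proof. by move=> h; apply/ler_addgt0Pr => e; exact: h. Qed.

Section Projection.
Context {R : realType} {H : completeNormedModType R[i]}.
Variable ip : {dot H for Num.conj}.
Hypothesis norm_ip : forall x : H, `|x| = sqrtC (ip x x).
Local Notation rip := (re_ip ip).

(** Projection theorem for the closure of a subspace [W], which is expressed by
    approximation: a minimizing sequence in [W] is Cauchy by the parallelogram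
    identity, and [u] is [x] minus its limit. *)
Lemma approx_orth_decomp (W : set H) (W0 : W 0)
    (WD : forall x y, W x -> W y -> W (x + y))
    (WZ : forall (a : R) x, W x -> W (a%:C *: x)) (x : H) :
  exists2 u, (forall w, W w -> rip u w = 0) &
    forall e : R, 0 < e -> exists2 w, W w & rnorm (x - u - w) < e.
Proof.
pose D := [set rnorm (x - w) | w in W]; pose d := inf D.
have Dinf : has_inf D.
  split; first by exists (rnorm (x - 0)); exists 0.
  by exists 0 => _ [w _ <-]; exact: rnorm_ge0.
have dle w : W w -> d <= rnorm (x - w).
  by move=> Ww; apply: ge_inf; [case: Dinf | exists w].
have d0 : 0 <= d.
  by apply: lb_le_inf; [case: Dinf | move=> _ [w _ <-]; exact: rnorm_ge0].
have /choice[s sP] : forall n, exists w, W w /\ rnorm (x - w) < d + n.+1%:R^-1.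
  move=> n; have n0 : 0 < n.+1%:R^-1 :> R by rewrite invr_gt0 ltr0n.
  by have [_ [w Ww <-] h] := inf_adherent n0 Dinf; exists w.
have [] := rnorm_complete (s := s).
  move=> e e0; have k0 : 0 < 8 * d + 4 by lra.
  have f0 : 0 < Num.min 1 (e ^+ 2 / (8 * d + 4)).
    by rewrite lt_min ltr01 divr_gt0 ?exprn_gt0.
  have [N NP] := natSinv_small f0; exists N => n m /NP + /NP.
  have [[Wn +] [Wm +]] := (sP n, sP m).
  have Wmid : W ((2^-1 : R)%:C *: (s n + s m)) by apply/WZ/WD.
  have := dle _ Wmid.
  have := rnorm_ge0 (x - s n); have := rnorm_ge0 (x - s m).
  have : 0 < n.+1%:R^-1 :> R by rewrite invr_gt0 ltr0n.
  have : 0 < m.+1%:R^-1 :> R by rewrite invr_gt0 ltr0n.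
  move: (n.+1%:R^-1) (m.+1%:R^-1) => p q q0 p0 bm0 bn0 hmid hn hm.
  rewrite !lt_min !ltr_pdivlMr // => /andP[p1 pe] /andP[q1 qe].
  have eD : rnorm (x - s n + (x - s m)) =
      2 * rnorm (x - (2^-1 : R)%:C *: (s n + s m)).
    rewrite -[X in X * _](ger0_norm (ler0n R 2)) -rnormZ; congr rnorm.
    rewrite scalerBr scalerA -rmorphM /= mulfV ?pnatr_eq0 // scale1r.
    by rewrite rmorphD /= scalerDl scale1r opprD addrACA.
  have eB : rnorm (x - s n - (x - s m)) = rnorm (s n - s m).
    by rewrite rnormC opprB addrC addrA subrK.
  have := rnorm_addE norm_ip (x - s n) (x - s m).
  have := rnorm_subE norm_ip (x - s n) (x - s m).
  rewrite eD eB => h1 h2.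
  rewrite -(@ltr_pXn2r _ 2) ?nnegrE ?rnorm_ge0 ?(ltW e0) //.
  move: h1 h2 bn0 bm0 hn hm hmid.
  move: (rnorm (x - _ *: _)) (rnorm (s n - s m)) (rnorm (x - s n))
    (rnorm (x - s m)) (re_ip _ _ _) => mid c a b r h1 h2 a0 b0 ha hb hmid.
  have hc : c ^+ 2 = 2 * a ^+ 2 + 2 * b ^+ 2 - 4 * mid ^+ 2 by lra.
  have h3 : a ^+ 2 <= (d + p) ^+ 2 by nra.
  have h4 : b ^+ 2 <= (d + q) ^+ 2 by nra.
  have h5 : d ^+ 2 <= mid ^+ 2 by nra.
  nra.
move=> l lP; pose u := x - l.
(* [u] realizes the distance [d] from [x] to [W]: the next two bounds. *)
have ule : rnorm u <= d.
  apply: le_eps => e e0; have e2 : 0 < e / 2 by lra.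
  have [N1 N1P] := natSinv_small e2; have [N2 N2P] := lP _ e2.
  have /N1P h1 := leq_maxl N1 N2; have /N2P h2 := leq_maxr N1 N2.
  have [_ h3] := sP (maxn N1 N2); move: h1 h2 h3.
  move: (maxn N1 N2) => n h1 h2 h3.
  have := rnormD (x - s n) (s n - l); rewrite addrA subrK -/u.
  by move: (n.+1%:R^-1) h1 h3 => p; lra.
have dleu w : W w -> d <= rnorm (u - w).
  move=> Ww; apply: le_eps => e e0; have [N /(_ _ (leqnn N)) NP] := lP _ e0.
  have := rnormB (u - w) (s N - l).
  have -> : u - w - (s N - l) = x - (s N + w).
    by rewrite /u opprB opprD addrACA !addrA subrK addrAC.
  have := dle _ (WD _ _ (proj1 (sP N)) Ww). lra.
exists u => [w Ww|e e0]; last first.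
  have [N /(_ _ (leqnn N)) NP] := lP _ e0; exists (s N); first by case: (sP N).
  have -> : x - u - s N = - (s N - l) by rewrite /u !opprB [x + _]addrC subrK.
  by rewrite rnormN.
suff : 2 * rip u w = 0 by move/eqP; rewrite mulf_eq0 pnatr_eq0 /= => /eqP.
apply: (@lin_quad0 _ _ (rnorm w ^+ 2)) => t.
have := dleu _ (WZ t w Ww); rewrite -(@ler_pXn2r _ 2) ?nnegrE ?rnorm_ge0 //.
rewrite (rnorm_subE norm_ip) ripZr rnormZ exprMn real_normK ?num_real // => h.
have : rnorm u ^+ 2 <= d ^+ 2 by rewrite ler_pXn2r ?nnegrE ?rnorm_ge0.
lra.
Qed.

(** Riesz representation of [x |-> ip (A x) y]: the vector is a multiple of the
    component [u] of some [x0] that is orthogonal to the kernel.  Continuity of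
    the functional makes the kernel closed, so that [u] is not in it. *)
Lemma adjoint_vector (A : H -> H) (C : R)
    (AD : forall x y, A (x + y) = A x + A y)
    (AZ : forall (w : R[i]) x, A (w *: x) = w *: A x)
    (Ab : forall x, rnorm (A x) <= C * rnorm x) (y : H) :
  exists z, forall x, ip (A x) y = ip x z.
Proof.
pose f x := ip (A x) y.
have fD x1 x2 : f (x1 + x2) = f x1 + f x2 by rewrite /f AD linearDl.
have fZ w x : f (w *: x) = w * f x by rewrite /f AZ linearZl_LR.
have fB x1 x2 : f (x1 - x2) = f x1 - f x2.
  by rewrite fD -scaleN1r fZ mulN1r.
have [f0|/existsNP[x0 /eqP fx0]] := pselect (forall x, f x = 0).
  by exists 0 => x; rewrite linear0r; exact: f0.
have [|||u u_perp u_approx] := @approx_orth_decomp [set x | f x = 0] _ _ _ x0.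
- by rewrite /= -(scale0r x0) fZ mul0r.
- by move=> x1 x2 /= h1 h2; rewrite fD h1 h2 addr0.
- by move=> a x /= h; rewrite fZ h mulr0.
have fu : f u = f x0.
  (* The real parts for [w = 1] and [w = 'i] determine [f (x0 - u)]. *)
  have fv w : `|w| = 1 -> rip (w *: A (x0 - u)) y = 0.
    move=> w1; apply/normr0_eq0/eqP; rewrite eq_le normr_ge0 andbT.
    pose K := `|C| * rnorm y.
    have K0 : 0 <= K by rewrite mulr_ge0 ?rnorm_ge0.
    apply: le_eps => e e0; rewrite add0r.
    have [|p /= fp] := u_approx (e / (K + 1)); first by rewrite divr_gt0 //; lra.
    rewrite ltr_pdivlMr; last by lra.
    move=> hp.
    have -> : rip (w *: A (x0 - u)) y = rip (w *: A (x0 - u - p)) y.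
      rewrite /re_ip !linearZl_LR /= -/(f (x0 - u)) -/(f (x0 - u - p)).
      by rewrite (fB _ p) fp subr0.
    have h1 : rnorm (w *: A (x0 - u - p)) <= `|C| * rnorm (x0 - u - p).
      rewrite rnormZ_unit //; apply: le_trans (Ab _) _.
      by rewrite ler_wpM2r ?rnorm_ge0 ?ler_norm.
    have h2 : `|rip (w *: A (x0 - u - p)) y| <= rnorm (w *: A (x0 - u - p)) * rnorm y.
      by rewrite ler_norml rip_ge // rip_le.
    apply: le_trans h2 _.
    have h3 := ler_wpM2r (rnorm_ge0 y) h1.
    apply: le_trans h3 _; rewrite mulrAC -/K mulrC.
    have := rnorm_ge0 (x0 - u - p); nra.
  apply/eqP; rewrite -subr_eq0 -opprB oppr_eq0 -fB; apply/eqP/ip_eq0.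
    by rewrite -[A _]scale1r fv // normr1.
  by rewrite fv // normc_def /= expr0n expr1n add0r sqrtr1.
have ip_perp w : f w = 0 -> ip w u = 0.
  move=> fw; apply: ip_eq0; rewrite ripC u_perp //=.
  by rewrite fZ fw mulr0.
have u0 : ip u u != 0.
  apply/eqP => /eqP; rewrite dnorm_eq0 => /eqP uE.
  by move: fx0; rewrite -fu uE -(scale0r x0) fZ mul0r eqxx.
exists ((Num.conj (f u) / ip u u) *: u) => x.
have /eqP : ip (f u *: x - f x *: u) u = 0.
  by apply: ip_perp; rewrite fB !fZ mulrC subrr.
rewrite linearBl /= !linearZl_LR /= subr_eq0 => /eqP E.
rewrite linearZr_LR /= rmorphM /= fmorphV conjCK.
rewrite [X in X^-1]conj_Creal; last by rewrite ger0_real ?dnorm_ge0.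
by rewrite mulrAC E mulfK.
Qed.

End Projection.

(** * Harnack domination as an inequality of quadratic forms *)

Section PolyOperator.
Context {R : realType} {H : completeNormedModType R[i]}.
Variable ip : {dot H for Num.conj}.
Hypothesis norm_ip : forall x : H, `|x| = sqrtC (ip x x).
Local Notation rip := (re_ip ip).
Implicit Types (p q : {poly R[i]}) (T : {linear H -> H}).

(** A common upper bound on the sizes makes polynomials of different degrees
    addable term by term. *)
Lemma poly_operatorE n p (A : H -> H) x : (size p <= n)%N ->
  poly_operator p A x = \sum_(k < n) p`_k *: iter k A x.
Proof.
move=> pn; rewrite /poly_operator fct_sumE.
rewrite (big_ord_widen _ (fun k => p`_k *: iter k A x) pn).
rewrite big_mkcond; apply: eq_bigr => k _; case: ifPn => //.
by rewrite -leqNgt => kp; rewrite nth_default // scale0r.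
Qed.

Lemma poly_operatorD p q (A : H -> H) x :
  poly_operator (p + q) A x = poly_operator p A x + poly_operator q A x.
Proof.
pose n := maxn (size p) (size q).
rewrite (@poly_operatorE n) ?size_polyD // (@poly_operatorE n p) ?leq_maxl //.
rewrite (@poly_operatorE n q) ?leq_maxr // -big_split; apply: eq_bigr => k _.
by rewrite coefD scalerDl.
Qed.

Lemma poly_operatorZ w p (A : H -> H) x :
  poly_operator (w *: p) A x = w *: poly_operator p A x.
Proof.
rewrite (@poly_operatorE (size p)) ?size_scale_leq // (@poly_operatorE (size p) p) //.
by rewrite scaler_sumr; apply: eq_bigr => k _; rewrite coefZ scalerA.
Qed.

Lemma poly_operatorN p (A : H -> H) x :
  poly_operator (- p) A x = - poly_operator p A x.
Proof. by rewrite -scaleN1r poly_operatorZ scaleN1r. Qed.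

Lemma poly_operator_sum (I : Type) (s : seq I) (F : I -> {poly R[i]}) (A : H -> H) x :
  poly_operator (\sum_(i <- s) F i) A x = \sum_(i <- s) poly_operator (F i) A x.
Proof.
elim: s => [|i s IHs]; last by rewrite !big_cons poly_operatorD IHs.
by rewrite !big_nil (@poly_operatorE 0) ?size_poly0 // big_ord0.
Qed.

Lemma poly_operatorXn n (A : H -> H) x : poly_operator 'X^n A x = iter n A x.
Proof.
rewrite (@poly_operatorE n.+1) ?size_polyXn // (bigD1 ord_max) //= coefXn eqxx.
rewrite scale1r big1 ?addr0 // => k kn; rewrite coefXn.
suff -> : (k == n :> nat) = false by rewrite scale0r.
by apply/negbTE.
Qed.

Lemma poly_operator1 (A : H -> H) x : poly_operator 1 A x = x.
Proof. by rewrite -(expr0 'X) poly_operatorXn. Qed.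

Lemma iterlinD n T x y : iter n T (x + y) = iter n T x + iter n T y.
Proof. by elim: n => //= n ->; rewrite linearD. Qed.

Lemma iterlinZ n T w x : iter n T (w *: x) = w *: iter n T x.
Proof. by elim: n => //= n ->; rewrite linearZ. Qed.

Lemma iter_scale n w T x : iter n (w \*: T) x = w ^+ n *: iter n T x.
Proof.
elim: n => [|n IHn]; first by rewrite expr0 scale1r.
by rewrite !iterS IHn /= linearZ /= scalerA exprS.
Qed.

Lemma iter_contr n (A : H -> H) x : (forall y, rnorm (A y) <= rnorm y) ->
  rnorm (iter n A x) <= rnorm x.
Proof. by move=> cA; elim: n => //= n IHn; apply: le_trans IHn. Qed.

(** The default value in the definition of [adjoint] is never reached for
    polynomials in a contraction. *)
Lemma adjoint_poly p T : (forall y, rnorm (T y) <= rnorm y) ->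
  forall x y, ip (poly_operator p T x) y = ip x (adjoint ip (poly_operator p T) y).
Proof.
move=> cT; suff /xgetPex : exists B, forall x y,
  ip (poly_operator p T x) y = ip x (B y) by apply.
suff /choice[B BP] : forall y, exists z, forall x, ip (poly_operator p T x) y = ip x z.
  by exists B.
move=> y; apply: (adjoint_vector norm_ip (C := \sum_(k < size p) complex.Re `|p`_k|)).
- move=> x1 x2; rewrite !(@poly_operatorE (size p)) // -big_split.
  by apply: eq_bigr => k _; rewrite iterlinD scalerDr.
- move=> w x; rewrite !(@poly_operatorE (size p)) // scaler_sumr.
  by apply: eq_bigr => k _; rewrite iterlinZ !scalerA mulrC.
move=> x; rewrite (@poly_operatorE (size p)) //.
apply: le_trans (rnorm_sum _ _ _) _; rewrite mulr_suml; apply: ler_sum => k _.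
rewrite rnormZC.
by rewrite ler_wpM2l ?iter_contr // -ler0c RRe_real ?normr_real.
Qed.

(** Harnack domination with constant [c], read on quadratic forms. *)
Definition harnack_le (c : R) (A A' : H -> H) : Prop :=
  forall p, (forall z : R[i], `|z| <= 1 -> 0 <= complex.Re p.[z]) ->
  forall x, rip (poly_operator p A x) x <= c * rip (poly_operator p A' x) x.

Lemma rip_operator_Re p T x : (forall y, rnorm (T y) <= rnorm y) ->
  rip (operator_Re ip (poly_operator p T) x) x = rip (poly_operator p T x) x.
Proof.
move=> cT; rewrite /operator_Re.
have -> : (2%:R^-1 : R[i]) = (2^-1 : R)%:C by rewrite fmorphV rmorph_nat.
rewrite ripZl ripDl [X in _ + X]ripC.
by rewrite {2}/re_ip -adjoint_poly // -/(re_ip _ _ _); field.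
Qed.

Lemma harnack_dominated_le T T' : (forall y, rnorm (T y) <= rnorm y) ->
  (forall y, rnorm (T' y) <= rnorm y) -> harnack_dominated ip T T' ->
  exists2 c : R, 1 <= c & harnack_le c T T'.
Proof.
move=> cT cT' [c c1 h]; exists c => // p p0 x; rewrite -subr_ge0.
have := h p p0 x; rewrite lecE => /andP[_] /=.
rewrite -/(re_ip ip _ x) ripBl.
rewrite [X in X - _]ripZl !rip_operator_Re //.
Qed.

(** Replacing [p] by [p(w z)] preserves positivity on the disc. *)
Lemma harnack_le_rot c T T' w : `|w| = 1 -> harnack_le c T T' ->
  harnack_le c (w \*: T) (w \*: T').
Proof.
move=> w1 h p p0 x; pose q := \poly_(k < size p) (p`_k * w ^+ k).
have qE (A : {linear H -> H}) : poly_operator p (w \*: A) x = poly_operator q A x.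
  rewrite (@poly_operatorE (size p)) // (@poly_operatorE (size p) q) ?size_poly //.
  apply: eq_bigr => k _; rewrite coef_poly ltn_ord -scalerA; congr (_ *: _).
  exact: iter_scale.
rewrite !qE; apply: h => z z1.
have -> : q.[z] = p.[w * z].
  rewrite horner_poly horner_coef; apply: eq_bigr => k _.
  by rewrite exprMn mulrA.
by apply: p0; rewrite normrM w1 mul1r.
Qed.

End PolyOperator.

(** * Fejer polynomials and orbit sums *)

(** Up to the factor [n], the analytic completion of the Fejer kernel:
    [n + 2 (n - 1) z + ... + 2 z^(n-1)], whose value at [1] is [n ^ 2]. *)
Definition fejer_poly (R : realType) (n : nat) : {poly R[i]} :=
  \sum_(m < n) ((\sum_(j < m.+1) 'X^j) *+ 2 - 1).

(** With [g_m = 1 + z + ... + z^(m-1)], the real part equals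
    [|g_n|^2 + (1 - |z|^2) sum_(m < n) |g_m|^2].  The induction step is the
    identity [2 Re g_(n+1) - 1 = |g_(n+1)|^2 - |g_(n+1) - 1|^2], in which
    [g_(n+1) - 1 = z g_n].  The formula is valid on the whole
    closed disc, not only on the circle. *)
Lemma fejer_poly_Re_ge0 (R : realType) n (z : R[i]) : `|z| <= 1 ->
  0 <= complex.Re (fejer_poly R n).[z].
Proof.
move=> z1; pose g m : R[i] := \sum_(j < m) z ^+ j.
pose sq (w : R[i]) : R := complex.Re w ^+ 2 + complex.Im w ^+ 2.
have gS m : g m.+1 = 1 + z * g m.
  rewrite /g big_ord_recl expr0 mulr_sumr; congr (_ + _).
  by apply: eq_bigr => j _; rewrite exprS.
have -> : complex.Re (fejer_poly R n).[z] =
    sq (g n) + (1 - sq z) * \sum_(m < n) sq (g m).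
  rewrite /fejer_poly; elim: n => [|n IHn].
    by rewrite !big_ord0 horner0 /sq /g big_ord0 /= expr0n /= mulr0 !addr0.
  rewrite big_ord_recr [in RHS]big_ord_recr /= hornerD raddfD /= IHn.
  rewrite hornerD hornerN hornerMn hornerC horner_sum.
  have -> : \sum_(j < n.+1) ('X^j).[z] = g n.+1.
    by apply: eq_bigr => j _; rewrite hornerXn.
  rewrite gS /sq mulr2n.
  case: (z) (g n) => a b [u v] /=; ring.
have z1' : sq z <= 1.
  rewrite -lecR add_Re2_Im2 (_ : 1%:C = 1) //.
  by rewrite expr_le1.
have sq0 w : 0 <= sq w by rewrite addr_ge0 ?sqr_ge0.
by rewrite addr_ge0 // mulr_ge0 ?subr_ge0 // sumr_ge0.
Qed.

Section Dynamics.
Context {R : realType} {H : completeNormedModType R[i]}.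
Variable ip : {dot H for Num.conj}.
Hypothesis norm_ip : forall x : H, `|x| = sqrtC (ip x x).
Local Notation rip := (re_ip ip).
Implicit Types (T : {linear H -> H}) (x y z : H).

Definition orbit_sum (m : nat) (A : H -> H) x := \sum_(j < m) iter j A x.

Definition fejer_op (n : nat) (A : H -> H) x :=
  \sum_(m < n) (orbit_sum m.+1 A x *+ 2 - x).

Lemma poly_operator_fejer n (A : H -> H) x :
  poly_operator (fejer_poly R n) A x = fejer_op n A x.
Proof.
rewrite poly_operator_sum; apply: eq_bigr => m _.
rewrite poly_operatorD poly_operatorN poly_operator1 mulr2n poly_operatorD.
rewrite poly_operator_sum; under eq_bigr do rewrite poly_operatorXn.
by rewrite -mulr2n.
Qed.

Definition contractive (A : H -> H) := forall x, rnorm (A x) <= rnorm x.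

Lemma harnack_le_fejer c (A A' : H -> H) n x : harnack_le ip c A A' ->
  rip (fejer_op n A x) x <= c * rip (fejer_op n A' x) x.
Proof.
move=> h; rewrite -!poly_operator_fejer; apply: h => z.
exact: fejer_poly_Re_ge0.
Qed.

Lemma harnack_le_sub1 c (A A' : H -> H) x : harnack_le ip c A A' ->
  rip (x - A x) x <= c * rip (x - A' x) x.
Proof.
move=> h; have E (B : H -> H) : x - B x = poly_operator (1 - 'X) B x.
  by rewrite poly_operatorD poly_operatorN poly_operator1 -['X]expr1 poly_operatorXn.
rewrite !E; apply: h => z z1; rewrite !hornerE raddfB /= subr_ge0.
apply: le_trans (ler_norm _) _; rewrite -lecR.
by apply: le_trans (normc_ge_Re _) _.
Qed.

(** A vector fixed by a contraction is fixed by its adjoint: compare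
    [|T (z + t x)|] with [|z + t x|] to first order in [t]. *)
Lemma fix_perp T x z : contractive T -> T z = z -> rip (T x - x) z = 0.
Proof.
move=> cT Tz; suff : 2 * rip (T x - x) z = 0.
  by move/eqP; rewrite mulf_eq0 pnatr_eq0 => /eqP.
apply: (@lin_quad0 _ _ (rnorm x ^+ 2)) => t.
have := cT (z + t%:C *: x); rewrite linearD linearZ /= Tz.
rewrite -(@ler_pXn2r _ 2) ?nnegrE ?rnorm_ge0 // !(rnorm_addE norm_ip).
rewrite !ripZr !rnormZ !exprMn real_normK ?num_real // ripBl.
rewrite (ripC ip (T x)) (ripC ip x) => h.
have : 0 <= t ^+ 2 * rnorm (T x) ^+ 2 by rewrite mulr_ge0 ?sqr_ge0.
lra.
Qed.

Lemma sqr_rnorm_defect T x : contractive T ->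
  rnorm (x - T x) ^+ 2 <= 2 * rip (x - T x) x.
Proof.
move=> cT; have : rnorm (T x) ^+ 2 <= rnorm x ^+ 2.
  by rewrite ler_pXn2r ?nnegrE ?rnorm_ge0.
rewrite (rnorm_subE norm_ip) ripBl -(rip_sqr norm_ip) (ripC ip (T x)); lra.
Qed.

(** Telescoping [x - T^j x], each difference being at most [|x - T x|]. *)
Lemma rnorm_iter_sub j T x : contractive T ->
  rnorm (x - iter j T x) <= j%:R * rnorm (x - T x).
Proof.
move=> cT; elim: j => [|j IHj]; first by rewrite subrr rnorm0 mul0r.
have -> : x - iter j.+1 T x = (x - T x) + T (x - iter j T x).
  by rewrite linearB addrA subrK.
apply: le_trans (rnormD _ _) _; have := cT (x - iter j T x).
by rewrite -natr1 mulrDl mul1r; lra.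
Qed.

Lemma orbit_sum_sub m T x :
  orbit_sum m T x - T (orbit_sum m T x) = x - iter m T x.
Proof.
rewrite /orbit_sum; elim: m => [|m IHm]; first by rewrite !big_ord0 linear0 !subrr.
by rewrite big_ord_recr /= linearD opprD addrACA IHm addrA subrK.
Qed.

Lemma orbit_sumD m T x y : orbit_sum m T (x + y) = orbit_sum m T x + orbit_sum m T y.
Proof. by rewrite -big_split; apply: eq_bigr => j _; rewrite iterlinD. Qed.

Lemma orbit_sum_comm m T x : orbit_sum m T (T x) = T (orbit_sum m T x).
Proof. by rewrite /orbit_sum linear_sum; apply: eq_bigr => j _; rewrite -iterSr. Qed.

Lemma rnorm_orbit_sum m T x : contractive T ->
  rnorm (orbit_sum m T x) <= m%:R * rnorm x.
Proof.
move=> cT; apply: le_trans (rnorm_sum _ _ _) _.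
rewrite mulr_natl -[m in leRHS]card_ord -sumr_const; apply: ler_sum => j _.
exact: iter_contr.
Qed.

(** Orbit sums of size [o(m)] make the Fejer operator of size [o(n ^ 2)]. *)
Lemma rnorm_fejer_op n (A : H -> H) x (e b : R) : 0 <= e ->
  (forall m, rnorm (orbit_sum m A x) <= m%:R * e + b) ->
  rnorm (fejer_op n A x) <= n%:R * (2 * (n%:R * e + b) + rnorm x).
Proof.
move=> e0 h; apply: le_trans (rnorm_sum _ _ _) _.
rewrite [leRHS]mulr_natl -[n in leRHS]card_ord -sumr_const; apply: ler_sum => m _.
apply: le_trans (rnormB _ _) _; rewrite lerD2r rnormMn -[leLHS]mulr_natl.
rewrite ler_pM2l // card_ord; apply: le_trans (h _) _; rewrite lerD2r ler_wpM2r //.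
by rewrite ler_nat.
Qed.

Lemma rnorm_orbit_sum_near m T x : contractive T ->
  rnorm (orbit_sum m T x - x *+ m) <= m%:R * (m%:R * rnorm (x - T x)).
Proof.
move=> cT; rewrite -[m in x *+ m]card_ord -sumr_const -sumrB.
apply: le_trans (rnorm_sum _ _ _) _.
rewrite [leRHS]mulr_natl -[X in _ *+ X]card_ord -sumr_const; apply: ler_sum => j _.
rewrite (rnormC (iter _ _ _)). apply: le_trans (rnorm_iter_sub _ _ cT) _.
by rewrite ler_wpM2r ?rnorm_ge0 // ler_nat ltnW.
Qed.

(** On an almost fixed vector the Fejer operator almost acts as
    multiplication by its value [n ^ 2] at [1]. *)
Lemma rnorm_fejer_op_near n T x : contractive T ->
  rnorm (fejer_op n T x - x *+ (n * n)) <=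
  n%:R * (2 * (n%:R * (n%:R * rnorm (x - T x)))).
Proof.
move=> cT.
have -> : fejer_op n T x - x *+ (n * n) =
    \sum_(m < n) (orbit_sum m.+1 T x - x *+ m.+1) *+ 2.
  rewrite /fejer_op; elim: n => [|n IHn]; first by rewrite !big_ord0 subr0.
  rewrite !big_ord_recr /= -IHn mulrnBl -mulrnA.
  have -> : (n.+1 * n.+1 = n * n + n.*2.+1)%N by rewrite -muln2; lia.
  rewrite mulrnDr opprD addrACA; congr (_ + _).
  rewrite -addrA; congr (_ + _); rewrite -opprD -mulrS; congr (- (_ *+ _)).
  by rewrite -muln2; lia.
apply: le_trans (rnorm_sum _ _ _) _.
rewrite [leRHS]mulr_natl -[X in _ *+ X]card_ord -sumr_const; apply: ler_sum => m _.
rewrite rnormMn -[leLHS]mulr_natl ler_pM2l //.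
apply: le_trans (rnorm_orbit_sum_near _ _ cT) _.
have mn : m.+1%:R <= n%:R :> R by rewrite ler_nat.
have d0 := rnorm_ge0 (x - T x).
by rewrite ler_pM ?mulr_ge0 ?ler0n // ler_wpM2r.
Qed.

End Dynamics.

(** * Transfer of fixed vectors and gaps *)

Section Transfer.
Context {R : realType} {H : completeNormedModType R[i]}.
Variable ip : {dot H for Num.conj}.
Hypothesis norm_ip : forall x : H, `|x| = sqrtC (ip x x).
Local Notation rip := (re_ip ip).
Implicit Types (T A : {linear H -> H}) (x y z : H) (w : R[i]).

Lemma natr_gt_ex (a : R) : exists n : nat, (0 < n)%N /\ a < n%:R.
Proof.
exists (Num.bound `|a|).+1; split=> //.
apply: le_lt_trans (ler_norm _) _; apply: lt_trans (archi_boundP _) _ => //.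
by rewrite ltr_nat.
Qed.

(** [|y|^2 <= K^2 |y - A y|^2 <= 2 K^2 Re <y - A y, y>
    <= 2 c K^2 Re <y - A' y, y>]. *)
Lemma harnack_gap_up c A A' y K : 0 <= c -> contractive A ->
  harnack_le ip c A A' -> 0 <= K ->
  rnorm y <= K * rnorm (y - A y) -> rnorm y <= 2 * c * K ^+ 2 * rnorm (y - A' y).
Proof.
move=> c0 cA h K0 hy.
have h1 := sqr_rnorm_defect norm_ip y cA; have h2 := harnack_le_sub1 y h.
have h3 : c * rip (y - A' y) y <= c * (rnorm (y - A' y) * rnorm y).
  by rewrite ler_wpM2l ?(rip_le norm_ip).
have [y0|] := leP (rnorm y) 0.
  by apply: le_trans y0 _; rewrite mulr_ge0 ?rnorm_ge0 // mulr_ge0 ?sqr_ge0 // mulr_ge0.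
move=> y0; rewrite -(ler_pM2l y0).
have : rnorm y ^+ 2 <= K ^+ 2 * rnorm (y - A y) ^+ 2.
  by rewrite -exprMn ler_pXn2r ?nnegrE ?rnorm_ge0 ?mulr_ge0 ?rnorm_ge0.
have := sqr_ge0 K; move: (K ^+ 2) => k k0 h4.
have : k * rnorm (y - A y) ^+ 2 <= k * (2 * (c * (rnorm (y - A' y) * rnorm y))).
  by rewrite ler_wpM2l //; lra.
lra.
Qed.

(** The constant is chosen before the operators because it has to serve for all
    the rotated pairs [(w T, w T')] at once.  The gap of [A'] is needed at the
    orbit sums of [y], which it bounds by [2 K |y|], because
    [1 - A'] maps them to [y - A'^m y]. *)
Lemma harnack_gap_down c K : 0 <= c -> 0 <= K ->
  exists K', forall A A' y, contractive A -> contractive A' ->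
    harnack_le ip c A A' ->
    (forall m, rnorm (orbit_sum m A' y) <=
       K * rnorm (orbit_sum m A' y - A' (orbit_sum m A' y))) ->
    rnorm y <= K' * rnorm (y - A y).
Proof.
(* This [n] makes [c n (4 K + 1) |y|^2], the bound for [p_n(A')], at most half of
   the main term [n ^ 2 |y|^2]. *)
move=> c0 K0; have [n [n0 hn]] := natr_gt_ex (2 * c * (4 * K + 1)).
exists (4 * n%:R) => A A' y cA cA' h hy.
have n0' : 0 < n%:R :> R by rewrite ltr0n.
have [y0|] := leP (rnorm y) 0.
  by apply: le_trans y0 _; rewrite mulr_ge0 ?rnorm_ge0 // mulr_ge0.
move=> y0; have d0 := rnorm_ge0 (y - A y).
have hA' : rnorm (fejer_op n A' y) <= n%:R * (4 * K + 1) * rnorm y.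
  have hO m : rnorm (orbit_sum m A' y) <= m%:R * 0 + 2 * K * rnorm y.
    rewrite mulr0 add0r; apply: le_trans (hy m) _; rewrite orbit_sum_sub.
    have : rnorm (y - iter m A' y) <= 2 * rnorm y.
      apply: le_trans (rnormB _ _) _.
      by have := @iter_contr _ _ m A' y cA'; lra.
    nra.
  by apply: le_trans (rnorm_fejer_op n (lexx 0) hO) _; lra.
have h1 := harnack_le_fejer n y h.
have h2 : c * rip (fejer_op n A' y) y <= c * (n%:R * (4 * K + 1) * rnorm y * rnorm y).
  rewrite ler_wpM2l //; apply: le_trans (rip_le norm_ip _ _) _.
  by rewrite ler_wpM2r ?rnorm_ge0.
have h3 := rnorm_fejer_op_near n y cA.
have h4 := rip_ge norm_ip (fejer_op n A y - y *+ (n * n)) y.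
have E : rip (fejer_op n A y - y *+ (n * n)) y =
    rip (fejer_op n A y) y - n%:R ^+ 2 * rnorm y ^+ 2.
  by rewrite ripBl ripMnl -(rip_sqr norm_ip) -[_ *+ (n * n)]mulr_natl natrM; ring.
rewrite E in h4 => {E}.
have h5 : rnorm (fejer_op n A y - y *+ (n * n)) * rnorm y <=
    n%:R * (2 * (n%:R * (n%:R * rnorm (y - A y)))) * rnorm y.
  by rewrite ler_wpM2r ?rnorm_ge0.
move: h1 h2 h4 h5 hn n0' d0.
move: (rip _ _) (rip _ _) (rnorm (_ - _ *+ _)) (rnorm (y - A y)) (n%:R) => a b r d N.
move=> h1 h2 h4 h5 hN N0 d0.
have h6 : N ^+ 2 * rnorm y ^+ 2 <=
    2 * N ^+ 3 * d * rnorm y + c * (N * (4 * K + 1) * rnorm y * rnorm y) by lra.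
have h7 : 2 * c * (4 * K + 1) * (N * rnorm y ^+ 2) <= N * (N * rnorm y ^+ 2).
  by rewrite ler_wpM2r ?(ltW hN) // mulr_ge0 ?(ltW N0) ?sqr_ge0.
have h8 : (N ^+ 2 * rnorm y) * rnorm y <= (N ^+ 2 * rnorm y) * (4 * N * d) by lra.
by move: h8; rewrite ler_pM2l // mulr_gt0 // exprn_gt0.
Qed.

(** The inclusion from right to left is the case [p = 1 - z].  The other one is a
    mean ergodic argument: Fejer means of [T'] tend to zero on the closure of
    the range of [1 - T']. *)
Lemma harnack_fix c T T' x : 0 <= c -> contractive T -> contractive T' ->
  harnack_le ip c T T' -> T x = x <-> T' x = x.
Proof.
move=> c0 cT cT' h.
have fix' y : T' y = y -> T y = y.
  move=> yE; have := harnack_le_sub1 y h; have := sqr_rnorm_defect norm_ip y cT.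
  rewrite yE subrr rip0l mulr0 => h1 h2.
  have /rnorm_eq0/eqP : rnorm (y - T y) = 0.
    by apply/eqP; rewrite -sqrf_eq0 eq_le sqr_ge0 andbT; lra.
  by rewrite subr_eq0 => /eqP.
split=> [xE|]; last exact: fix'.
have [|a b [p ->] [q ->]|a y [p ->]|u u_perp u_approx] :=
    @approx_orth_decomp _ _ _ norm_ip [set y | exists p, y = p - T' p] _ _ _ x.
- by exists 0; rewrite linear0 subr0.
- by exists (p + q); rewrite linearD opprD addrACA.
- by exists (a%:C *: p); rewrite linearZ scalerBr.
have uE : T' u = u.
  have h0 : rip u (u - T' u) = 0 by apply: u_perp; exists u.
  have := sqr_rnorm_defect norm_ip u cT'; rewrite ripC h0 mulr0 => h1.
  have /rnorm_eq0/eqP : rnorm (u - T' u) = 0.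
    by apply/eqP; rewrite -sqrf_eq0 eq_le sqr_ge0 andbT.
  by rewrite subr_eq0 => /eqP.
(* [v = x - u] is fixed by [T] and lies in the closure of the range of [1 - T']. *)
suff v0 : rnorm (x - u) = 0 by have /eqP := rnorm_eq0 v0; rewrite subr_eq0 => /eqP ->.
have vE : T (x - u) = x - u by rewrite linearB xE fix'.
move: u_approx vE; move: (x - u) => v v_approx vE {x xE u u_perp uE}.
apply/eqP/negPn/negP => v_neq0.
have v0 : 0 < rnorm v by rewrite lt_def v_neq0 rnorm_ge0.
(* With this [e], the part of [c |p_n(T') v|] that grows like [n ^ 2] is at most
   [n ^ 2 |v| / 2]; [n] is then taken large enough for the rest. *)
pose e := rnorm v / (4 * c + 1); have e0 : 0 < e by rewrite divr_gt0 //; lra.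
have [_ [p ->] hp] := v_approx _ e0.
have [n [n0 hn]] := natr_gt_ex (2 * c * (4 * rnorm p + rnorm v) / rnorm v).
have n0' : 0 < n%:R :> R by rewrite ltr0n.
have hA' : rnorm (fejer_op n T' v) <= n%:R * (2 * (n%:R * e + 2 * rnorm p) + rnorm v).
  apply: rnorm_fejer_op => [|m]; first exact: ltW.
  rewrite -[v in leLHS](subrK (p - T' p)) orbit_sumD.
  apply: le_trans (rnormD _ _) _; apply: lerD.
    apply: le_trans (rnorm_orbit_sum _ _ cT') _.
    by rewrite ler_wpM2l // ltW.
  have -> : orbit_sum m T' (p - T' p) = p - iter m T' p.
    apply/eqP; rewrite -orbit_sum_sub eq_sym subr_eq -orbit_sum_comm.
    by rewrite -orbit_sumD subrK.
  apply: le_trans (rnormB _ _) _.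
  by have := @iter_contr _ _ m T' p cT'; lra.
have h1 := harnack_le_fejer n v h.
have E : fejer_op n T v = v *+ (n * n).
  have := rnorm_fejer_op_near n v cT; rewrite vE subrr rnorm0 !mulr0 => h0.
  have /rnorm_eq0/eqP : rnorm (fejer_op n T v - v *+ (n * n)) = 0.
    by apply/eqP; rewrite eq_le h0 rnorm_ge0.
  by rewrite subr_eq0 => /eqP.
rewrite E ripMnl -(rip_sqr norm_ip) -[_ *+ (n * n)]mulr_natl natrM in h1 => {E}.
have h2 : c * rip (fejer_op n T' v) v <=
    c * (n%:R * (2 * (n%:R * e + 2 * rnorm p) + rnorm v) * rnorm v).
  rewrite ler_wpM2l //; apply: le_trans (rip_le norm_ip _ _) _.
  by rewrite ler_wpM2r ?rnorm_ge0.
have he : e * (4 * c + 1) = rnorm v by rewrite /e divfK // gt_eqF //; lra.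
move: hn; rewrite ltr_pdivrMr // => hn.
have p0 := rnorm_ge0 p.
move: h1 h2 hn he n0' v0 e0 p0; clear.
move: (rip _ _) (rnorm v) (rnorm p) (n%:R) (e) => r V P N {}e.
move=> h1 h2 hn he N0 V0 e0 P0.
have h3 : N * (N * V) * V <= N * (c * (2 * (N * e + 2 * P) + V)) * V by lra.
move: h3; rewrite ler_pM2r // ler_pM2l // => h3.
have h4 : c * (2 * (N * e)) <= N * V / 2.
  by rewrite -he; have : 0 <= N * e by [rewrite mulr_ge0 ?ltW]; lra.
lra.
Qed.

Definition perp_fix (T : H -> H) y : Prop := forall z, T z = z -> rip y z = 0.

(** With [w = 1] this is the spectral gap that governs Cesaro means; all
    unimodular [w] together govern the powers. *)
Definition gap (T : H -> H) (K : R) w : Prop :=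
  forall y, perp_fix T y -> rnorm y <= K * rnorm (y - w *: T y).

Lemma perp_fixD (T : H -> H) x y : perp_fix T x -> perp_fix T y -> perp_fix T (x + y).
Proof. by move=> px py z zE; rewrite ripDl px // py // addr0. Qed.

Lemma perp_fix_rot T w y : contractive T -> perp_fix T y -> perp_fix T (w *: T y).
Proof.
move=> cT py z zE; have -> : rip (w *: T y) z = rip (T y) (Num.conj w *: z).
  by rewrite /re_ip linearZl_LR linearZr_LR /= conjCK.
have fixz : T (Num.conj w *: z) = Num.conj w *: z by rewrite linearZ /= zE.
by have := fix_perp norm_ip y cT fixz; rewrite ripBl py // subr0.
Qed.

Lemma perp_fix_orbit (T A : H -> H) m y :
  (forall z, perp_fix T z -> perp_fix T (A z)) -> perp_fix T y ->
  perp_fix T (orbit_sum m A y).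
Proof.
move=> pA py; have py' j : perp_fix T (iter j A y) by elim: j => // j; apply: pA.
rewrite /orbit_sum; apply: (big_ind (perp_fix T)).
- by move=> z _; rewrite rip0l.
- by move=> *; apply: perp_fixD.
- by move=> j _; apply: py'.
Qed.

Lemma gap_abs T K w : gap T K w -> gap T `|K| w.
Proof.
move=> g y py; apply: le_trans (g y py) _.
by rewrite ler_wpM2r ?rnorm_ge0 ?ler_norm.
Qed.

(** The set [U] is [{1}] for Cesaro means and the unit circle for powers; the
    constant is uniform over [U]. *)
Lemma harnack_gap c T T' (U : set R[i]) : 0 <= c -> contractive T -> contractive T' ->
  harnack_le ip c T T' -> (forall w, U w -> `|w| = 1) ->
  (exists K, forall w, U w -> gap T K w) <-> (exists K, forall w, U w -> gap T' K w).
Proof.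
move=> c0 cT cT' h U1.
have eq_perp y : perp_fix T y <-> perp_fix T' y.
  by split=> py z zE; apply: py; apply/(harnack_fix z c0 cT cT' h).
have cw A w : `|w| = 1 -> contractive A -> contractive (w \*: A).
  by move=> w1 cA x; rewrite /= rnormZ_unit.
split=> -[K gK].
  exists (2 * c * `|K| ^+ 2) => w Uw y /eq_perp py.
  have w1 := U1 _ Uw.
  have := harnack_gap_up c0 (cw _ _ w1 cT) (harnack_le_rot w1 h) (normr_ge0 K).
  by apply; exact: gap_abs (gK w Uw) y py.
have [K' K'P] := harnack_gap_down c0 (normr_ge0 K).
exists K' => w Uw y py; have w1 := U1 _ Uw.
have := K'P _ _ y (cw _ _ w1 cT) (cw _ _ w1 cT') (harnack_le_rot w1 h).
apply=> m; have /(_ (orbit_sum m (w \*: T') y)) := gap_abs (gK w Uw).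
apply; apply: perp_fix_orbit => [z|]; [exact: perp_fix_rot | exact/eq_perp].
Qed.

End Transfer.

(** * Roots of unity and the Parseval identity *)

Lemma exists_prim_root (F : closedFieldType) n : n%:R != 0 :> F ->
  exists z : F, n.-primitive_root z.
Proof.
move=> nF; have n0 : (0 < n)%N by rewrite lt0n; apply: contraNneq nF => ->.
have [rs] := closed_field_poly_normal ('X^n - 1 : {poly F}).
rewrite (monicP (monicXnsubC 1 n0)) scale1r => rsE.
have rsU : all n.-unity_root rs.
  by apply/allP => z; rewrite -root_prod_XsubC -rsE.
have rs_uniq : uniq rs by rewrite -separable_prod_XsubC -rsE separable_Xn_sub_1.
have size_rs : (n <= size rs)%N.
  by rewrite -ltnS -(size_prod_XsubC rs id) -rsE size_XnsubC.
by have /hasP[z _ zP] := has_prim_root n0 rsU rs_uniq size_rs; exists z.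
Qed.

Lemma sum_prim_root (F : fieldType) n (z : F) (i j : 'I_n) :
  n.-primitive_root z ->
  \sum_(k < n) (z ^+ k) ^+ i * (z ^+ k) ^- j = (n * (i == j))%:R.
Proof.
move=> zP; have z0 : z != 0 by rewrite (prim_root_eq0 zP) -lt0n (prim_order_gt0 zP).
pose u := z ^+ i / z ^+ j.
have -> : \sum_(k < n) (z ^+ k) ^+ i * (z ^+ k) ^- j = \sum_(k < n) u ^+ k.
  by apply: eq_bigr => k _; rewrite expr_div_n -!exprM ![(k * _)%N]mulnC.
have [eij|ij] := eqVneq i j.
  under eq_bigr do rewrite /u eij divff ?expf_neq0 // expr1n.
  by rewrite sumr_const card_ord muln1.
have u1 : u - 1 != 0.
  rewrite subr_eq0 /u; apply: contra ij => /eqP h.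
  have /eqP : z ^+ i = z ^+ j by rewrite -[LHS](divfK (expf_neq0 j z0)) h mul1r.
  by rewrite (eq_prim_root_expr zP) !modn_small.
apply/eqP; rewrite muln0 -(mulrI_eq0 _ (mulfI u1)) -subrX1 subr_eq0 /u.
by rewrite expr_div_n -!exprM ![(_ * n)%N]mulnC !exprM (prim_expr_order zP) !expr1n divr1.
Qed.

Section Parseval.
Context {R : realType} {H : completeNormedModType R[i]}.
Variable ip : {dot H for Num.conj}.
Hypothesis norm_ip : forall x : H, `|x| = sqrtC (ip x x).
Local Notation rip := (re_ip ip).

Lemma prim_root_norm n (z : R[i]) : n.-primitive_root z -> `|z| = 1.
Proof.
move=> zP; apply/eqP; rewrite -(@pexpr_eq1 _ _ n) ?(prim_order_gt0 zP) //.
by rewrite -normrX (prim_expr_order zP) normr1.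
Qed.

(** Parseval identity for the discrete Fourier transform on [Z / n]. *)
Lemma parseval n (z : R[i]) (a : 'I_n -> H) : n.-primitive_root z ->
  \sum_(k < n) rnorm (\sum_(j < n) (z ^+ k) ^+ j *: a j) ^+ 2 =
  n%:R * \sum_(j < n) rnorm (a j) ^+ 2.
Proof.
move=> zP.
have sqC (x : H) : (rnorm x ^+ 2)%:C = ip x x.
  by rewrite rmorphXn /= -rnormE norm_ip sqrtCK.
apply: complexI; rewrite rmorphM rmorph_nat !rmorph_sum /=.
transitivity (\sum_(k < n) \sum_(i < n) \sum_(j < n)
    (z ^+ k) ^+ i * (z ^+ k) ^- j * ip (a i) (a j)).
  apply: eq_bigr => k _; rewrite sqC linear_sumlz; apply: eq_bigr => i _.
  rewrite linear_sumr; apply: eq_bigr => j _.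
  rewrite linearZl_LR linearZr_LR /= mulrA; congr (_ * _ * _).
  have zk1 : `|(z ^+ k) ^+ j| = 1 by rewrite !normrX (prim_root_norm zP) !expr1n.
  by rewrite invC_norm zk1 expr1n invr1 mul1r.
rewrite exchange_big mulr_sumr; apply: eq_bigr => i _.
rewrite exchange_big (bigD1 i) //= [X in _ + X]big1 ?addr0 => [|j ji].
  by rewrite -mulr_suml sum_prim_root // eqxx muln1 sqC.
by rewrite -mulr_suml sum_prim_root // eq_sym (negPf ji) muln0 mul0r.
Qed.

End Parseval.

(** * Operator norm and uniform convergence *)

Section OpNorm.
Context {R : realType} {H : completeNormedModType R[i]}.
Implicit Types (x : H) (A : H -> H).

Lemma opnorm_le A (e : R) : 0 <= e ->
  (forall x, rnorm (A x) <= e * rnorm x) -> opnorm A <= e.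
Proof.
move=> e0 Ae; apply: ge_sup.
  by exists (rnorm (A 0)), 0 => //=; rewrite normr0.
move=> _ [x /= x1 <-]; apply: le_trans (Ae x) _.
by rewrite ler_piMr // -lecR -rnormE.
Qed.

Lemma opnorm_ge0 A (e : R) : (forall x, rnorm (A x) <= e * rnorm x) -> 0 <= opnorm A.
Proof.
move=> Ae; apply: le_trans (rnorm_ge0 (A 0)) _; apply: ub_le_sup.
  exists `|e| => _ [x /= x1 <-]; apply: le_trans (Ae x) _.
  apply: le_trans (ler_wpM2r (rnorm_ge0 x) (ler_norm e)) _.
  by rewrite ler_piMr // -lecR -rnormE.
by exists 0 => //=; rewrite normr0.
Qed.

Lemma rnorm_opnorm A (C : R) x : (forall (a : R) y, A (a%:C *: y) = a%:C *: A y) ->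
  (forall y, rnorm (A y) <= C * rnorm y) -> rnorm (A x) <= opnorm A * rnorm x.
Proof.
move=> AZ AC; have [x0|x0] := eqVneq (rnorm x) 0.
  by have := AC x; rewrite x0 !mulr0.
have x_gt0 : 0 < rnorm x by rewrite lt_def x0 rnorm_ge0.
rewrite -ler_pdivrMr // mulrC -[X in X * _]ger0_norm ?invr_ge0 ?rnorm_ge0 //.
rewrite -rnormZ -AZ; apply: ub_le_sup.
  exists `|C| => _ [y /= y1 <-]; apply: le_trans (AC y) _.
  apply: le_trans (ler_wpM2r (rnorm_ge0 y) (ler_norm C)) _.
  by rewrite ler_piMr // -lecR -rnormE.
exists ((rnorm x)^-1%:C *: x) => //=.
by rewrite rnormE rnormZ ger0_norm ?invr_ge0 ?rnorm_ge0 // mulVf.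
Qed.

Lemma bounded_operatorP (L : {linear H -> H}) :
  bounded_operator L <-> exists C : R, forall x, rnorm (L x) <= C * rnorm x.
Proof.
split=> [/linear_boundedP/pinfty_ex_gt0[r r0 h]|[C h]].
  have rE : r = (complex.Re r)%:C by rewrite RRe_real // gtr0_real.
  exists (complex.Re r) => x; have := h x.
  by rewrite rE !rnormE -rmorphM lecR /=.
apply/linear_boundedP; near=> r => x; rewrite rnormE.
apply: (@le_trans _ _ (C%:C * `|x|)); first by rewrite rnormE -rmorphM lecR.
apply: ler_wpM2r => //; near: r; apply: nbhs_pinfty_ge.
by rewrite complex_real.
Unshelve. all: by end_near. Qed.

Lemma contraction_contractive (T : {linear H -> H}) :
  contraction_operator T -> contractive T.
Proof.
move=> [/bounded_operatorP[C TC] T1] x.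
apply: le_trans (rnorm_opnorm x _ TC) _; first by move=> a y; rewrite linearZ.
by rewrite ler_piMl ?rnorm_ge0.
Qed.

(** The supremum in [opnorm] controls [|A x|] for every [x] only when [A] is
    homogeneous and bounded, whence the hypotheses on [S]. *)
Lemma uniformly_convergentP (S : nat -> H -> H) :
  (forall n (a : R) x, S n (a%:C *: x) = a%:C *: S n x) ->
  (forall n, contractive (S n)) ->
  uniformly_convergent S <->
  exists L : {linear H -> H}, bounded_operator L /\
    forall e : R, 0 < e -> exists N, forall n, (N <= n)%N ->
      forall x, rnorm (S n x - L x) <= e * rnorm x.
Proof.
move=> SZ cS; split=> [[L bL /cvgrPdist_le SL]|[L [bL SL]]].
  exists L; split=> // e /SL[N _ NP]; exists N => n Nn x.
  have [C LC] := (bounded_operatorP L).1 bL.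
  have Ab y : rnorm ((S n \- L) y) <= (1 + C) * rnorm y.
    by apply: le_trans (rnormB _ _) _; rewrite mulrDl mul1r lerD // cS.
  have := NP n Nn => /=; rewrite sub0r normrN => h.
  apply: le_trans (@rnorm_opnorm (S n \- L) _ x _ Ab) _.
    by move=> a y /=; rewrite SZ linearZ scalerBr.
  by rewrite ler_wpM2r ?rnorm_ge0 // (le_trans (ler_norm _) h).
exists L => //; apply/cvgrPdist_le => e e0; have [N NP] := SL _ e0.
exists N => // n /= Nn; rewrite sub0r normrN ger0_norm.
  by apply: opnorm_le (NP n Nn); rewrite ltW.
exact: opnorm_ge0 (NP n Nn).
Qed.

End OpNorm.

(** * Uniform convergence characterized by gaps *)

Section Characterization.
Context {R : realType} {H : completeNormedModType R[i]}.
Variable ip : {dot H for Num.conj}.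
Hypothesis norm_ip : forall x : H, `|x| = sqrtC (ip x x).
Local Notation rip := (re_ip ip).
Implicit Types (T L : {linear H -> H}) (x y z : H).

Definition fix_projector T L : Prop :=
  forall x, T (L x) = L x /\ perp_fix ip T (x - L x).

Lemma rnorm_fix_projector T L x : fix_projector T L -> rnorm (L x) <= rnorm x.
Proof.
move=> LP; have [LE Lx] := LP x; have := Lx _ LE.
rewrite ripBl -(rip_sqr norm_ip) => /eqP; rewrite subr_eq0 => /eqP h.
have [->|L0] := eqVneq (rnorm (L x)) 0; first exact: rnorm_ge0.
have L_gt0 : 0 < rnorm (L x) by rewrite lt_def L0 rnorm_ge0.
by rewrite -(ler_pM2r L_gt0) -expr2 -h (rip_le norm_ip).
Qed.

Lemma fix_projector_bounded T L : fix_projector T L -> bounded_operator L.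
Proof.
move=> LP; apply/bounded_operatorP; exists 1 => x.
by rewrite mul1r (rnorm_fix_projector x LP).
Qed.

(** Both properties of the projector pass to the limit: [x - S n x] is already
    orthogonal to the fixed vectors, and [S n x] is fixed up to [e]. *)
Lemma limit_fix_projector T L (S : nat -> H -> H) : contractive T ->
  (forall n x z, T z = z -> rip (x - S n x) z = 0) ->
  (forall x (e : R), 0 < e -> exists n,
     rnorm (S n x - L x) <= e /\ rnorm (S n x - T (S n x)) <= e) ->
  fix_projector T L.
Proof.
move=> cT Sperp SL x; split.
  apply/eqP; rewrite -subr_eq0; apply/eqP/rnorm_eq0/eqP.
  rewrite eq_le rnorm_ge0 andbT; apply: le_eps => e e0; rewrite add0r.
  have e3 : 0 < e / 3 by lra.
  have [n [h1 h2]] := SL x _ e3.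
  have -> : T (L x) - L x = (S n x - L x) - (T (S n x - L x) + (S n x - T (S n x))).
    rewrite linearB [X in _ = _ - X]addrC addrA subrK.
    by rewrite opprB [RHS]addrC addrA subrK.
  apply: le_trans (rnormB _ _) _.
  have := rnormD (T (S n x - L x)) (S n x - T (S n x)); have := cT (S n x - L x); lra.
move=> z zE; apply/normr0_eq0/eqP.
rewrite eq_le normr_ge0 andbT; apply: le_eps => e e0; rewrite add0r.
have z1 : 0 < rnorm z + 1 by rewrite ltr_wpDl ?rnorm_ge0.
have [n [h1 _]] := SL x (e / (rnorm z + 1)) (divr_gt0 e0 z1).
have -> : rip (x - L x) z = rip (S n x - L x) z.
  have -> : x - L x = (x - S n x) + (S n x - L x) by rewrite addrA subrK.
  by rewrite ripDl Sperp // add0r.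
have : `|rip (S n x - L x) z| <= rnorm (S n x - L x) * rnorm z.
  by rewrite ler_norml rip_ge // rip_le.
move/le_trans; apply; move: h1; rewrite ler_pdivlMr // => h1.
have := rnorm_ge0 (S n x - L x); lra.
Qed.

Lemma perp_iter_sub n T x z : contractive T -> T z = z -> rip (x - iter n T x) z = 0.
Proof.
move=> cT zE; elim: n => [|n IHn]; first by rewrite subrr rip0l.
have -> : x - iter n.+1 T x = (x - iter n T x) - (T (iter n T x) - iter n T x).
  by rewrite iterS opprB addrA subrK.
by rewrite ripBl IHn (fix_perp norm_ip _ cT zE) subr0.
Qed.

Lemma rnorm_half K x y :
  rnorm y <= rnorm x / 2 -> rnorm (x - y) <= K -> rnorm x <= 2 * K.
Proof. by move=> h1 h2; have := rnormD (x - y) y; rewrite subrK; lra. Qed.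

Lemma cesaro_meanE T n x :
  cesaro_mean T n x = (n.+1%:R^-1 : R)%:C *: orbit_sum n.+1 T x.
Proof. by rewrite /cesaro_mean /= fct_sumE fmorphV rmorph_nat. Qed.

Lemma scale_natK n x : (n.+1%:R^-1 : R)%:C *: (x *+ n.+1) = x.
Proof.
rewrite -[x *+ _]scaler_nat scalerA -(rmorph_nat (real_complex R)) -rmorphM.
by rewrite mulVf ?pnatr_eq0 // scale1r.
Qed.

Lemma cesaro_subE T n x :
  x - cesaro_mean T n x = (n.+1%:R^-1 : R)%:C *: (x *+ n.+1 - orbit_sum n.+1 T x).
Proof. by rewrite scalerBr scale_natK cesaro_meanE. Qed.

Lemma cesaro_mean_sub T n x : contractive T ->
  rnorm (x - cesaro_mean T n x) <= n.+1%:R * rnorm (x - T x).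
Proof.
move=> cT; rewrite cesaro_subE rnormZ.
have n0 : 0 < n.+1%:R :> R by rewrite ltr0n.
rewrite ger0_norm ?invr_ge0 ?ler0n // mulrC ler_pdivrMr // (rnormC (x *+ _)).
by apply: le_trans (rnorm_orbit_sum_near _ _ cT) _; rewrite mulrC.
Qed.

Lemma cesaro_mean_contractive T n : contractive T -> contractive (cesaro_mean T n).
Proof.
move=> cT x; rewrite cesaro_meanE rnormZ ger0_norm ?invr_ge0 ?ler0n //.
by rewrite mulrC ler_pdivrMr ?ltr0n // mulrC rnorm_orbit_sum.
Qed.

Lemma cesaro_meanZ T n (a : R) x :
  cesaro_mean T n (a%:C *: x) = a%:C *: cesaro_mean T n x.
Proof.
rewrite !cesaro_meanE scalerA mulrC -scalerA; congr (_ *: _).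
by rewrite scaler_sumr; apply: eq_bigr => j _; rewrite iterlinZ.
Qed.

Lemma perp_cesaro_sub n T x z : contractive T -> T z = z ->
  rip (x - cesaro_mean T n x) z = 0.
Proof.
move=> cT zE; rewrite cesaro_subE ripZl.
rewrite -[X in x *+ X](card_ord n.+1) -sumr_const -sumrB.
rewrite (_ : rip _ _ = 0) ?mulr0 //; apply: (big_ind (fun y => rip y z = 0)).
- exact: rip0l.
- by move=> u v hu hv; rewrite ripDl hu hv addr0.
- by move=> j _; apply: perp_iter_sub.
Qed.

Lemma fix_projector_perp T L y : fix_projector T L -> perp_fix ip T y -> L y = 0.
Proof.
move=> LP py; have [LE Ly] := LP y; have := Ly _ LE.
rewrite ripBl py // sub0r -(rip_sqr norm_ip) => /eqP.
by rewrite oppr_eq0 sqrf_eq0 => /eqP /rnorm_eq0.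
Qed.

Lemma rnorm_sub_fix_projector T L x : fix_projector T L -> rnorm (x - L x) <= 2 * rnorm x.
Proof.
move=> LP; apply: le_trans (rnormB _ _) _.
by have := rnorm_fix_projector x LP; lra.
Qed.

(** If [|M_n y| <= |y| / 2] for a single [n], then [y - M_n y], which is at most a
    constant times [y - T y], is at least [|y| / 2].  Conversely
    [M_n x - L x = M_n y] with [y = x - L x], and the gap at the orbit sum gives
    [|M_n y| <= 2 K |y| / (n + 1)]. *)
Lemma uniformly_cesaro_ergodicP T : contractive T ->
  uniformly_cesaro_ergodic T <->
  (exists L, fix_projector T L) /\ (exists K, gap ip T K 1).
Proof.
move=> cT; rewrite /uniformly_cesaro_ergodic uniformly_convergentP; last 2 first.
- exact: cesaro_meanZ.
- by move=> n; apply: cesaro_mean_contractive.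
split=> [[L [bL ML]]|[[L LP] [K0 /gap_abs gK]]].
  have LP : fix_projector T L.
    apply: (@limit_fix_projector _ _ (cesaro_mean T)) => // [n x z|x e e0].
      exact: perp_cesaro_sub.
    have r1 : 0 < rnorm x + 1 by rewrite ltr_wpDl ?rnorm_ge0.
    have [N1 N1P] := ML _ (divr_gt0 e0 r1).
    have [N2 N2P] := natSinv_small (divr_gt0 e0 (mulr_gt0 (ltr0n R 2) r1)).
    exists (maxn N1 N2); split.
      apply: le_trans (N1P _ (leq_maxl _ _) x) _.
      rewrite mulrAC ler_pdivrMr // ler_pM2l //; lra.
    have /N2P : (N2 <= maxn N1 N2)%N by exact: leq_maxr.
    move: (maxn N1 N2) => n.
    rewrite cesaro_meanE linearZ /= -scalerBr orbit_sum_sub rnormZ.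
    rewrite ger0_norm ?invr_ge0 ?ler0n // => hn.
    have : rnorm (x - iter n.+1 T x) <= 2 * rnorm x.
      apply: le_trans (rnormB _ _) _; have := @iter_contr _ _ n.+1 T x cT; lra.
    have : 0 < n.+1%:R^-1 :> R by rewrite invr_gt0 ltr0n.
    move: hn; move: (n.+1%:R^-1) => p; rewrite ltr_pdivlMr; last by lra.
    have := rnorm_ge0 x; nra.
  split; first by exists L.
  have half_gt0 : 0 < 2^-1 :> R by lra.
  have [N /(_ _ (leqnn N)) NP] := ML _ half_gt0.
  exists (2 * N.+1%:R) => y py; rewrite scale1r -mulrA.
  have := NP y; rewrite (fix_projector_perp LP py) subr0 mulrC => h.
  exact: (rnorm_half h (cesaro_mean_sub _ _ cT)).
exists L; split; first exact: fix_projector_bounded LP.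
move=> e e0; pose K := `|K0|; have K_ge0 : 0 <= K by exact: normr_ge0.
have K1 : 0 < 4 * K + 1 by lra.
have [N NP] := natSinv_small (divr_gt0 e0 K1).
exists N => n /NP hn x; have [LE Lx] := LP x.
have -> : cesaro_mean T n x - L x = (n.+1%:R^-1 : R)%:C *: orbit_sum n.+1 T (x - L x).
  have -> : cesaro_mean T n x = cesaro_mean T n (x - L x + L x) by rewrite subrK.
  rewrite cesaro_meanE orbit_sumD scalerDr.
  suff -> : orbit_sum n.+1 T (L x) = L x *+ n.+1 by rewrite scale_natK addrK.
  rewrite -[X in _ = _ *+ X](card_ord n.+1) -sumr_const; apply: eq_bigr => j _.
  by elim: (j : nat) => //= m ->.
rewrite rnormZ ger0_norm ?invr_ge0 ?ler0n //.
have py m : perp_fix ip T (orbit_sum m T (x - L x)).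
  apply: perp_fix_orbit => // y /(perp_fix_rot norm_ip 1 cT).
  by rewrite scale1r.
have := gK _ (py n.+1); rewrite scale1r orbit_sum_sub -/K.
have := rnorm_sub_fix_projector x LP.
have : rnorm (x - L x - iter n.+1 T (x - L x)) <= 2 * rnorm (x - L x).
  apply: le_trans (rnormB _ _) _; have := @iter_contr _ _ n.+1 T (x - L x) cT; lra.
move: hn; have : 0 < n.+1%:R^-1 :> R by rewrite invr_gt0 ltr0n.
have := rnorm_ge0 x.
move: (n.+1%:R^-1) (rnorm (orbit_sum _ _ _)) (rnorm (_ - iter _ _ _))
  (rnorm (x - L x)) (rnorm x).
move=> p a b d r r0 p0; rewrite ltr_pdivlMr; last by lra.
move=> hp hb hd ha.
have : a <= 4 * K * r by nra.
nra.
Qed.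

(** Averaging over the [n]-th roots of unity the squared norms of the twisted
    orbit sums [sum_(j < n) w^j T^j y], each of which is at most [2 K |y|]. *)
Lemma power_decay T K y n : contractive T ->
  (forall w : R[i], `|w| = 1 -> gap ip T K w) -> perp_fix ip T y ->
  n%:R * rnorm (iter n T y) ^+ 2 <= 4 * K ^+ 2 * rnorm y ^+ 2.
Proof.
move=> cT gK py; have [->|n_neq0] := eqVneq n 0.
  by rewrite mul0r mulr_ge0 ?sqr_ge0 // mulr_ge0 ?sqr_ge0.
have n0 : 0 < n%:R :> R by rewrite ltr0n lt0n.
have [z zP] : exists z : R[i], n.-primitive_root z.
  by apply: exists_prim_root; rewrite pnatr_eq0.
have := parseval norm_ip (fun j => iter j T y) zP => /= sumE.
have le_sum : n%:R * rnorm (iter n T y) ^+ 2 <= \sum_(j < n) rnorm (iter j T y) ^+ 2.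
  rewrite mulr_natl -[X in _ *+ X](card_ord n) -sumr_const; apply: ler_sum => j _.
  rewrite ler_pXn2r ?nnegrE ?rnorm_ge0 // -{1}(subnK (ltnW (ltn_ord j))) iterD.
  exact: iter_contr.
apply: le_trans le_sum _; rewrite -(ler_pM2l n0) -sumE.
rewrite [leRHS]mulr_natl -[X in _ *+ X](card_ord n) -sumr_const; apply: ler_sum => k _.
pose w := z ^+ k; have w1 : `|w| = 1 by rewrite normrX (prim_root_norm zP) expr1n.
have cw : contractive (w \*: T) by move=> x; rewrite /= rnormZ_unit.
have -> : \sum_(j < n) w ^+ j *: iter j T y = orbit_sum n (w \*: T) y.
  by apply: eq_bigr => j _; rewrite iter_scale.
have pw : perp_fix ip T (orbit_sum n (w \*: T) y).
  by apply: perp_fix_orbit => // x; apply: perp_fix_rot.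
have := gK w w1 _ pw.
rewrite -[w *: T _]/((w \*: T) _) orbit_sum_sub => h1.
have h2 : rnorm (y - iter n (w \*: T) y) <= 2 * rnorm y.
  apply: le_trans (rnormB _ _) _; have := @iter_contr _ _ n _ y cw; lra.
move: h1 h2; rewrite -/w.
move: (rnorm (orbit_sum _ _ _)) (rnorm_ge0 (orbit_sum n (w \*: T) y)).
move: (rnorm (_ - _)) (rnorm_ge0 (y - iter n (w \*: T) y)) (rnorm y).
move=> d d0 r a a0 h1 h2; have h3 : a ^+ 2 <= K ^+ 2 * d ^+ 2.
  by rewrite -exprMn ler_pXn2r ?nnegrE // (le_trans a0).
apply: le_trans h3 _; have : d ^+ 2 <= (2 * r) ^+ 2.
  by rewrite ler_pXn2r ?nnegrE // (le_trans d0).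
by move/(ler_wpM2l (sqr_ge0 K)); lra.
Qed.

(** If [|T^n y| <= |y| / 2] for a single [n], then [|y - w^n T^n y| >= |y| / 2] for
    all unimodular [w], and the left side is at most [n |y - w T y|].  The converse
    is [power_decay]. *)
Lemma uniformly_convergent_powerP T : contractive T ->
  uniformly_convergent (fun n => iter n T) <->
  (exists L, fix_projector T L) /\
  (exists K, forall w : R[i], `|w| = 1 -> gap ip T K w).
Proof.
move=> cT; rewrite uniformly_convergentP; last 2 first.
- by move=> n a x; rewrite iterlinZ.
- by move=> n x; apply: iter_contr.
split=> [[L [bL TL]]|[[L LP] [K gK]]].
  have LP : fix_projector T L.
    apply: (@limit_fix_projector _ _ (fun n => iter n T)) => // [n x z|x e e0].
      exact: perp_iter_sub.
    have r1 : 0 < 2 * (rnorm x + 1).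
      by rewrite mulr_gt0 // ltr_wpDl ?rnorm_ge0.
    have [N NP] := TL _ (divr_gt0 e0 r1); exists N.
    have dE : e / (2 * (rnorm x + 1)) * rnorm x <= e / 2.
      by rewrite mulrAC ler_pdivrMr //; have := rnorm_ge0 x; nra.
    have h1 := le_trans (NP N (leqnn N) x) dE.
    have h2 := le_trans (NP N.+1 (leqnSn N) x) dE.
    split; first by apply: le_trans h1 _; lra.
    have -> : iter N T x - T (iter N T x) = (iter N T x - L x) - (iter N.+1 T x - L x).
      by rewrite opprB addrA subrK.
    by apply: le_trans (rnormB _ _) _; lra.
  split; first by exists L.
  have half_gt0 : 0 < 2^-1 :> R by lra.
  have [N /(_ _ (leqnn N)) NP] := TL _ half_gt0.
  exists (2 * N%:R) => w w1 y py; rewrite -mulrA.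
  have cw : contractive (w \*: T) by move=> x; rewrite /= rnormZ_unit.
  have := NP y; rewrite (fix_projector_perp LP py) subr0 mulrC => h.
  apply: (rnorm_half (y := iter N (w \*: T) y)).
    by rewrite iter_scale rnormZ_unit // normrX w1 expr1n.
  exact: rnorm_iter_sub cw.
exists L; split; first exact: fix_projector_bounded LP.
move=> e e0; have [N [N0 hN]] := natr_gt_ex (16 * K ^+ 2 / e ^+ 2).
exists N => n Nn x; have [LE Lx] := LP x.
have -> : iter n T x - L x = iter n T (x - L x).
  have -> : iter n T x = iter n T (x - L x + L x) by rewrite subrK.
  rewrite iterlinD.
  by rewrite (_ : iter n T (L x) = L x) ?addrK //; elim: (n) => //= m ->.
have := power_decay n cT gK Lx.
have := rnorm_sub_fix_projector x LP.
have n0 : 0 < n%:R :> R by rewrite ltr0n (leq_trans N0).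
have : 16 * K ^+ 2 < n%:R * e ^+ 2.
  rewrite -ltr_pdivrMr ?exprn_gt0 //; apply: lt_le_trans hN _.
  by rewrite ler_nat.
move: (rnorm_ge0 (iter n T (x - L x))) (rnorm_ge0 (x - L x)) (rnorm_ge0 x) n0.
move: (rnorm (iter _ _ _)) (rnorm (x - L x)) (rnorm x) (n%:R) => a d r m.
move=> a0 d0 r0 m0 h1 h2 h3.
have h4 : d ^+ 2 <= (2 * r) ^+ 2 by rewrite ler_pXn2r ?nnegrE ?mulr_ge0.
have := ler_wpM2l (sqr_ge0 K) h4 => h5.
have h6 : 16 * K ^+ 2 * r ^+ 2 <= m * e ^+ 2 * r ^+ 2.
  by rewrite ler_wpM2r ?sqr_ge0 // ltW.
have : m * a ^+ 2 <= m * (e * r) ^+ 2 by lra.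
by rewrite ler_pM2l // ler_pXn2r ?nnegrE // mulr_ge0 // ltW.
Qed.

End Characterization.

Theorem corollary4p7 (R : realType) (H : completeNormedModType R[i])
    (ip : {dot H for Num.conj})
    (norm_ip : forall x : H, `|x| = sqrtC (ip x x))
    (T T' : {linear H -> H})
    (contrT : contraction_operator T) (contrT' : contraction_operator T')
    (TT' : harnack_dominated ip T T') :
  (uniformly_cesaro_ergodic T <-> uniformly_cesaro_ergodic T') /\
  (uniformly_convergent (fun n => iter n T) <->
   uniformly_convergent (fun n => iter n T')).
Proof.
have cT := contraction_contractive contrT.
have cT' := contraction_contractive contrT'.
have [c c1 h] := harnack_dominated_le norm_ip cT cT' TT'.
have c0 : 0 <= c := le_trans ler01 c1.
have fixE z : T z = z <-> T' z = z := harnack_fix norm_ip z c0 cT cT' h.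
have projE : (exists L, fix_projector ip T L) <-> (exists L, fix_projector ip T' L).
  split=> -[L LP]; exists L => x; have [LE Lx] := LP x;
    by split=> [|z zE]; [apply/fixE | apply: Lx; apply/fixE].
have gapE := @harnack_gap _ _ _ norm_ip c T T' _ c0 cT cT' h.
split.
  rewrite !(uniformly_cesaro_ergodicP norm_ip) // projE.
  have gap1 A : (exists K, gap ip A K 1) <->
      (exists K, forall w : R[i], [set 1] w -> gap ip A K w).
    by split=> -[K gK]; exists K; [move=> w -> | apply: gK].
  have unit1 (w : R[i]) : [set 1] w -> `|w| = 1 by move=> ->; rewrite normr1.
  by rewrite !gap1 (gapE [set 1] unit1).
rewrite !(uniformly_convergent_powerP norm_ip) // projE.
by rewrite (gapE [set w : R[i] | `|w| = 1]).
Qed.
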